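(* Let $\mathfrak m_0=\{[0,0],[0,1],[0,1],[1,1],[1,2]\}$. Then: (a) $\mathfrak m_0$ is not of Speh type. (b) $\mathfrak m_0$ has exactly nine standard orders. Six of them are $\mathcal G_1=([1,1],[1,2],[0,1],[0,0],[0,1])$, $\mathcal G_2=([1,1],[1,2],[0,1],[0,1],[0,0])$, $\mathcal G_3=([1,2],[0,1],[0,1],[1,1],[0,0])$, $\mathcal G_4=([1,2],[0,1],[1,1],[0,1],[0,0])$, $\mathcal G_5=([1,2],[1,1],[0,1],[0,0],[0,1])$, $\mathcal G_6=([1,2],[1,1],[0,1],[0,1],[0,0])$, and the remaining three are $\mathcal W_1=([1,2],[1,1],[0,0],[0,1],[0,1])$, $\mathcal W_2=([1,1],[1,2],[0,0],[0,1],[0,1])$, $\mathcal W_3=([1,2],[0,1],[1,1],[0,0],[0,1])$. (c) Each of $\mathcal G_1,\ldots,\mathcal G_6$ admits a non-trivial relevant decomposition, whereas none of $\mathcal W_1,\mathcal W_2,\mathcal W_3$ admits any relevant decomposition. Consequently, $\mathfrak m_0$ is not distinguished, and $\mathcal W_1,\mathcal W_2,\mathcal W_3$ are precisely its strong witnesses. (d) The standard orders of $\mathfrak m_0$ with non-increasing endpoints are exactly $\mathcal G_3,\mathcal G_4,\mathcal G_6$. Hence no witness for $\mathfrak m_0$ has non-increasing endpoints. On the other hand, $\mathcal W_1$ and $\mathcal W_2$ have non-increasing beginnings.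
   Context: A segment is a set $[a,b]=\{a,a+1,\ldots,b\}$ of consecutive integers, $a\le b$; write $\mathbf b([a,b])=a$ (beginning), $\mathbf e([a,b])=b$ (endpoint), and $\mathrm{Sgm}$ for the set of segments. Put $\nu[a,b]=[a+1,b+1]$. A multisegment is a finitely supported function $\mathfrak m:\mathrm{Sgm}\to\mathbb Z_{\ge0}$ (a finite multiset of segments); sums are pointwise; $(\nu\mathfrak m)(\Delta)=\mathfrak m(\nu^{-1}\Delta)$. An order of $\mathfrak m$ is a listing (sequence of segments) $(\Delta_1,\ldots,\Delta_k)$ in which each segment $\Delta$ occurs exactly $\mathfrak m(\Delta)$ times; orders are counted as sequences of segments, so equal segments are not distinguished. Write $[a,b]\prec[a',b']$ if $a<a'$, $b<b'$ and $b\ge a'-1$. An order is standard if $\Delta_i\not\prec\Delta_j$ whenever $i<j$. A decomposition of a segment $\Delta$ is a tuple of segments $(\Delta_1,\ldots,\Delta_r)$, $r\ge1$, with $\mathbf e(\Delta_1)=\mathbf e(\Delta)$, $\mathbf b(\Delta_r)=\mathbf b(\Delta)$ and $\mathbf e(\Delta_{i+1})=\mathbf b(\Delta_i)-1$ for $1\le i\le r-1$. A decomposition of an order $(\Delta_1,\ldots,\Delta_k)$ is a choice of a decomposition $(\Delta_{i,1},\ldots,\Delta_{i,k_i})$ of each $\Delta_i$; it is trivial if all $k_i=1$. Its index set is $I=\{(i,j):1\le i\le k,\ 1\le j\le k_i\}$, ordered lexicographically ($\prec_{\mathrm{lex}}$), and $(i,j)\ll(i',j')$ means $i<i'$. The decomposition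 is relevant to the order if there is an involution $\tau:I\to I$ with: (R1) $\tau(i,j+1)\ll\tau(i,j)$ for all $1\le i\le k$, $1\le j\le k_i-1$; (R2) $\tau(\imath)\ne\imath$ for all $\imath\in I$; (R3) $\Delta_\imath=\nu\Delta_{\tau(\imath)}$ whenever $\imath\prec_{\mathrm{lex}}\tau(\imath)$. $\mathfrak m$ is distinguished if every standard order of $\mathfrak m$ admits a relevant decomposition. $\mathfrak m$ is of Speh type if $\mathfrak m=\mathfrak n+\nu\mathfrak n$ for some multisegment $\mathfrak n$. A witness for $\mathfrak m$ is a standard order of $\mathfrak m$ that admits no non-trivial relevant decomposition; a strong witness is a standard order that admits no relevant decomposition at all. *)

(* Defs.v *)
From HB Require Import structures.
From mathcomp Require Import all_boot all_order all_algebra.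
From mathcomp Require Import finmap multiset.

Set Implicit Arguments.
Unset Strict Implicit.
Unset Printing Implicit Defensive.

Import Order.TTheory GRing.Theory Num.Theory.

Local Open Scope fset_scope.
Local Open Scope mset_scope.
Local Open Scope ring_scope.

(* The segment {a, a + 1, ..., b} is represented by the pair (a, b). *)
Record segment := Segment {
  bounds : int * int;
  _ : bounds.1 <= bounds.2
}.

HB.instance Definition _ := [isSub for bounds].
HB.instance Definition _ := [Countable of segment by <:].

(* For closed integer literals only: [isT] checks a <= b by computation. *)
Notation Sg a b := (@Segment (a%R, b%R) isT).

Definition sg_begin (D : segment) : int := (bounds D).1.
Definition sg_end (D : segment) : int := (bounds D).2.

Fact shift_subproof (D : segment) (c : int) :
  (sg_begin D + c, sg_end D + c).1 <= (sg_begin D + c, sg_end D + c).2.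
Proof. by rewrite /= lerD2r; case: D. Qed.

Definition shift (D : segment) (c : int) : segment :=
  Segment (shift_subproof D c).

Definition nu (D : segment) : segment := shift D 1.
Definition nu_inv (D : segment) : segment := shift D (- 1).

Lemma nuK : cancel nu nu_inv.
Proof.
by case=> -[a b] h; apply: val_inj; rewrite /= /sg_begin /sg_end /= !addrK.
Qed.

Lemma nu_invK : cancel nu_inv nu.
Proof.
by case=> -[a b] h; apply: val_inj; rewrite /= /sg_begin /sg_end /= !subrK.
Qed.

Fact nu_mset_key : unit. Proof. exact: tt. Qed.
Definition nu_mset (m : {mset segment}) : {mset segment} :=
  [mset[nu_mset_key] D in [fset nu D' | D' in finsupp m] => m (nu_inv D)].

Lemma nu_msetE (m : {mset segment}) (D : segment) :
  nu_mset m D = m (nu_inv D).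
Proof.
rewrite fsfunE; case: ifPn => // nD; apply/esym/eqP.
apply: contraNT nD; rewrite -mem_finsupp => mD.
by apply/imfsetP; exists (nu_inv D); rewrite ?nu_invK.
Qed.

Definition speh_type (m : {mset segment}) : Prop :=
  exists n : {mset segment}, m = n `+` nu_mset n.

Definition prec (D D' : segment) : bool :=
  [&& sg_begin D < sg_begin D', sg_end D < sg_end D'
    & sg_begin D' - 1 <= sg_end D].

Definition order_of (m : {mset segment}) (s : seq segment) : Prop :=
  forall D : segment, count_mem D s = m D.

Definition standard (s : seq segment) : bool :=
  pairwise (fun D D' => ~~ prec D D') s.

Definition standard_order (m : {mset segment}) (s : seq segment) : Prop :=
  order_of m s /\ standard s.

Definition seg_decomposition (D : segment) (t : seq segment) : bool :=
  if t is D1 :: t' then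
    [&& sg_end D1 == sg_end D, sg_begin (last D1 t') == sg_begin D
      & path (fun E E' => sg_end E' == sg_begin E - 1) D1 t']
  else false.

Definition decomposition (s : seq segment) (d : seq (seq segment)) : bool :=
  all2 seg_decomposition s d.

Definition trivial_decomposition (d : seq (seq segment)) : bool :=
  all (fun t : seq segment => size t == 1%N) d.

(* Both components are counted from 0. *)
Definition dec_index (d : seq (seq segment)) : finType :=
  {i : 'I_(size d) & 'I_(size (tnth (in_tuple d) i))}.

Definition row_ix (d : seq (seq segment)) (x : dec_index d) : nat := tag x.
Definition col_ix (d : seq (seq segment)) (x : dec_index d) : nat := tagged x.

Definition piece (d : seq (seq segment)) (x : dec_index d) : segment :=
  tnth (in_tuple (tnth (in_tuple d) (tag x))) (tagged x).

Definition lt_row (d : seq (seq segment)) (x y : dec_index d) : bool :=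
  (row_ix x < row_ix y)%N.

Definition lt_lex (d : seq (seq segment)) (x y : dec_index d) : bool :=
  (row_ix x < row_ix y)%N ||
  (row_ix x == row_ix y) && (col_ix x < col_ix y)%N.

Definition relevant (d : seq (seq segment)) : Prop :=
  exists tau : dec_index d -> dec_index d,
    [/\ involutive tau,
        forall x y : dec_index d, row_ix y = row_ix x -> col_ix y = (col_ix x).+1 ->
          lt_row (tau y) (tau x),
        forall x : dec_index d, tau x <> x
      & forall x : dec_index d, lt_lex x (tau x) -> piece x = nu (piece (tau x))].

Definition relevant_decomposition (s : seq segment) (d : seq (seq segment)) :
    Prop :=
  decomposition s d /\ relevant d.

Definition distinguished (m : {mset segment}) : Prop :=
  forall s, standard_order m s -> exists d, relevant_decomposition s d.

Definition witness (m : {mset segment}) (s : seq segment) : Prop :=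
  standard_order m s /\
  ~ exists d, relevant_decomposition s d /\ ~~ trivial_decomposition d.

Definition strong_witness (m : {mset segment}) (s : seq segment) : Prop :=
  standard_order m s /\ ~ exists d, relevant_decomposition s d.

Definition nonincreasing_ends (s : seq segment) : bool :=
  sorted (fun D D' => sg_end D' <= sg_end D) s.

Definition nonincreasing_begins (s : seq segment) : bool :=
  sorted (fun D D' => sg_begin D' <= sg_begin D) s.

Definition m0 : {mset segment} :=
  [mset Sg 0 0; Sg 0 1; Sg 0 1; Sg 1 1; Sg 1 2].

Definition G1 := [:: Sg 1 1; Sg 1 2; Sg 0 1; Sg 0 0; Sg 0 1].
Definition G2 := [:: Sg 1 1; Sg 1 2; Sg 0 1; Sg 0 1; Sg 0 0].
Definition G3 := [:: Sg 1 2; Sg 0 1; Sg 0 1; Sg 1 1; Sg 0 0].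
Definition G4 := [:: Sg 1 2; Sg 0 1; Sg 1 1; Sg 0 1; Sg 0 0].
Definition G5 := [:: Sg 1 2; Sg 1 1; Sg 0 1; Sg 0 0; Sg 0 1].
Definition G6 := [:: Sg 1 2; Sg 1 1; Sg 0 1; Sg 0 1; Sg 0 0].
Definition W1 := [:: Sg 1 2; Sg 1 1; Sg 0 0; Sg 0 1; Sg 0 1].
Definition W2 := [:: Sg 1 1; Sg 1 2; Sg 0 0; Sg 0 1; Sg 0 1].
Definition W3 := [:: Sg 1 2; Sg 0 1; Sg 1 1; Sg 0 0; Sg 0 1].

(* Main.v *)
Require Import Defs.
From mathcomp Require Import all_boot all_order all_algebra.
From mathcomp Require Import finmap multiset.
From mathcomp Require Import zify.

Set Implicit Arguments.
Unset Strict Implicit.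
Unset Printing Implicit Defensive.

Import Order.TTheory GRing.Theory Num.Theory.

(** If m = n + nu n and the segment nu^-1 D is not in m, then the copies of D
    in m all come from n, so m contains at least as many copies of nu D.  In m0
    this fails for D = [0,1], which occurs twice, while [-1,0] is absent and
    [1,2] occurs once.

    The standard orders are found among the 60 listings of m0.

    Call a row the pieces of one segment of the order.  Relevance pairs off the
    pieces so that in each pair the earlier one is nu of the later one, and
    (R1) forces the partners of the successive pieces of a row into strictly
    earlier and earlier rows; in particular two consecutive pieces of a row are
    never partners.  In m0 only [0,1] and [1,2] can be split, as ([1,1],[0,0])
    and ([2,2],[1,1]).  An unsplit [0,1] must be the partner of an unsplit
    [1,2] and conversely, so either [1,2] and one of the [0,1] stay whole, or
    all three are split.

    In each G_i but G_3 some [0,1] lies between [1,1] and [0,0].  Split it: its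
    piece [1,1] is paired with the later [0,0], its piece [0,0] with the earlier
    [1,1], and the other [0,1] with [1,2].  For
    G_3 = ([1,2],[0,1],[0,1],[1,1],[0,0]) split all three long segments; the
    pieces of rows 1 to 5 are then [2,2], [1,1] | [1,1], [0,0] | [1,1], [0,0] |
    [1,1] | [0,0], and the pairs are [2,2] with the [1,1] of row 4, and the
    [1,1] of rows 1, 2, 3 with the [0,0] of rows 2, 3, 5.

    Each W_i ends with [0,1].  If this last segment is split, its piece [1,1]
    has no later [0,0] but the one of its own row, so its partner is [2,2] in
    the row of [1,2], and by (R1) the piece [0,0] of the last row has its
    partner in a row before that of [1,2].  Such a row exists only in W_2,
    where the partner is the initial [1,1]; all three long segments being
    split, the piece [1,1] of row 4 is then left with the [0,0] of its own row,
    which is forbidden.  If the last segment is whole, then so is [1,2], and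
    the other [0,1] is split.  In W_1 and W_2 it is preceded by [0,0], so its
    piece [1,1] has no later [0,0] outside its row; in W_3 the single [0,0]
    outside its row is needed by the segment [1,1] following it.

    The case analysis of the last two paragraphs is evaluated by a decision
    procedure for relevance: [relevantP] reduces it to a search among the
    involutions of the finite list of positions, and [decompositionP]
    enumerates the decompositions. *)

(** * Multisegments and their orders *)

Lemma speh_type_chain (m : {mset segment}%mset) (D : segment) :
  speh_type m -> m (nu_inv D) = 0 -> m D <= m (nu D).
Proof.
case=> n ->; rewrite !msetE2 !nu_msetE nuK => /eqP.
by rewrite addn_eq0 => /andP[/eqP-> _]; rewrite addn0 leq_addl.
Qed.

Lemma order_of_seq_mset (s t : seq segment) :
  order_of (seq_mset s) t <-> perm_eq t s.
Proof.
split=> [h|/permP h D]; last by rewrite mset_seqE h.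
by apply/allP=> D _ /=; rewrite h mset_seqE eqxx.
Qed.

Lemma m0_seq_mset : m0 = seq_mset G1.
Proof.
apply/msetP=> D; rewrite mset_seqE /m0 !msetE2 !msetnE /=.
rewrite !(eq_sym _ D).
by case: (D == Sg 0 0); case: (D == Sg 0 1); case: (D == Sg 1 1);
  case: (D == Sg 1 2).
Qed.

(** * Decompositions of orders with short segments *)

Fixpoint choices (T : Type) (ls : seq (seq T)) : seq (seq T) :=
  if ls is l :: ls' then [seq x :: xs | x <- l, xs <- choices ls']
  else [:: [::]].

Lemma mem_choices (T : eqType) (ls : seq (seq T)) (xs : seq T) :
  (xs \in choices ls) = all2 (fun l x => x \in l) ls xs.
Proof.
elim: ls xs => [|l ls IH] [|x xs] //=; first by apply/allpairsP=> -[[]] ? ? [].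
rewrite -IH; apply/allpairsP/andP => [[[y ys] /= [yl ysl [-> ->]]] //|[xl xsl]].
by exists (x, xs).
Qed.

Definition point (c : int) : segment := @Segment (c, c) (lexx c).

Lemma pointE (c : int) :
  (sg_begin (point c) = c) * (sg_end (point c) = c).
Proof. by []. Qed.

(** These are all the decompositions only when the segment has at most two
    elements, the case of every segment of [m0]. *)
Definition splits (D : segment) : seq (seq segment) :=
  if sg_end D == (sg_begin D + 1)%R
  then [:: [:: D]; [:: point (sg_end D); point (sg_begin D)]]
  else [:: [:: D]].

Lemma segment_eqE (D E : segment) :
  D = E <-> sg_begin D = sg_begin E /\ sg_end D = sg_end E.
Proof.
split=> [->//|]; case: D E => [[a b] h] [[c d] k].
rewrite /sg_begin /sg_end /= => -[ac bd].
by apply: val_inj; rewrite /= ac bd.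
Qed.

Lemma sg_begin_le_end (D : segment) : (sg_begin D <= sg_end D)%R.
Proof. by case: D. Qed.

(** The beginnings strictly decrease along a decomposition, so a segment with at
    most two elements has at most two pieces. *)
Lemma splitsP (D : segment) (t : seq segment) :
  (sg_end D <= sg_begin D + 1)%R ->
  reflect (seg_decomposition D t) (t \in splits D).
Proof.
move=> short; apply: (iffP idP).
  rewrite /splits; case: ifP => [/eqP De|_]; rewrite !inE.
    by case/orP=> /eqP->; rewrite /= ?pointE ?eqxx // De addrK eqxx.
  by move/eqP->; rewrite /= !eqxx.
have hD := sg_begin_le_end D.
case: t => [//|E1 [|E2 [|E3 t]]] /=.
- case/and3P=> /eqP e1 /eqP b1 _.
  have -> : E1 = D by apply/segment_eqE.
  by rewrite /splits; case: ifP => _; rewrite mem_head.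
- case/and3P=> /eqP e1 /eqP b2 /andP[/eqP e2 _].
  have h1 := sg_begin_le_end E1; have h2 := sg_begin_le_end E2.
  have De : sg_end D = (sg_begin D + 1)%R by lia.
  rewrite /splits De eqxx !inE; apply/orP; right; apply/eqP.
  by congr [:: _; _]; apply/segment_eqE; split; rewrite pointE; lia.
(* Three pieces: the last begins at least two below the first. *)
case/and3P=> /eqP e1 /eqP bl /and3P[/eqP e2 /eqP e3 pt].
have h1 := sg_begin_le_end E1; have h2 := sg_begin_le_end E2.
have h3 := sg_begin_le_end E3.
have : (sg_begin (last E3 t) <= sg_begin E3)%R.
  elim: t E3 {e3 h3 bl} pt => [//|E t IH] E3 /= /andP[/eqP e4 /IH].
  have := sg_begin_le_end E; lia.
lia.
Qed.

Lemma decompositionP (s : seq segment) (d : seq (seq segment)) :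
  all (fun D => sg_end D <= sg_begin D + 1)%R s ->
  decomposition s d = (d \in choices [seq splits D | D <- s]).
Proof.
rewrite mem_choices /decomposition.
elim: s d => [|D s IH] [|t d] //= /andP[hD hs].
by rewrite IH //; congr (_ && _); apply/idP/splitsP.
Qed.

(** * Deciding relevance *)

(** A position (i, j) in plain numbers, so that enumerations of positions
    reduce by computation. *)
Definition cell := (nat * nat)%type.

Definition cells (d : seq (seq segment)) : seq cell :=
  [seq (i, j) | i <- iota 0 (size d), j <- iota 0 (size (nth [::] d i))].

Definition cell_of (d : seq (seq segment)) (x : dec_index d) : cell :=
  (row_ix x, col_ix x).

Definition entry (d : seq (seq segment)) (c : cell) : segment :=
  nth (point 0) (nth [::] d c.1) c.2.

Lemma piece_entry (d : seq (seq segment)) (x : dec_index d) :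
  piece x = entry d (cell_of x).
Proof.
rewrite /piece (tnth_nth (point 0)) /entry.
by congr (nth _ _ _); apply: tnth_nth.
Qed.

Lemma cell_of_inj (d : seq (seq segment)) : injective (@cell_of d).
Proof.
case=> [i j] [i' j'] []; rewrite /row_ix /col_ix /= => /ord_inj ii'.
by subst i' => /ord_inj->.
Qed.

Lemma cell_ofP (d : seq (seq segment)) (c : cell) :
  reflect (exists x : dec_index d, cell_of x = c) (c \in cells d).
Proof.
apply: (iffP allpairsPdep) => [[i [j [+ + ->]]]|[[i j] <-]].
  rewrite !mem_iota !add0n /= => id jd.
  have jd' : j < size (tnth (in_tuple d) (Ordinal id)).
    by rewrite (tnth_nth [::]).
  by exists (existT _ (Ordinal id) (Ordinal jd')).
exists (val i), (val j); rewrite !mem_iota !add0n /= ltn_ord; split=> //.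
by rewrite -(tnth_nth [::] (in_tuple d)) ltn_ord.
Qed.

Definition lex_cell (c c' : cell) : bool :=
  (c.1 < c'.1) || (c.1 == c'.1) && (c.2 < c'.2).

(** Both lexicographic directions are tested, so that this relation expresses
    (R2) and (R3) for a pair of partners listed in either order. *)
Definition linked (d : seq (seq segment)) (c c' : cell) : bool :=
  [&& c' != c, lex_cell c c' ==> (entry d c == nu (entry d c'))
    & lex_cell c' c ==> (entry d c' == nu (entry d c))].

Definition pairing (d : seq (seq segment)) (f : cell -> cell) : bool :=
  all (fun c =>
    [&& f c \in cells d, f (f c) == c, linked d c (f c)
      & ((c.1, c.2.+1) \in cells d) ==> ((f (c.1, c.2.+1)).1 < (f c).1)])
    (cells d).

(** Indices and positions correspond bijectively through [cell_of], along which
    the involution is transported in either direction. *)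
Lemma relevant_pairing (d : seq (seq segment)) :
  relevant d <-> exists f, pairing d f.
Proof.
split=> [[tau [tauK R1 R2 R3]]|[f /allP fP]].
  pose f c := if [pick x : dec_index d | cell_of x == c] is Some x
              then cell_of (tau x) else c.
  have fE x : f (cell_of x) = cell_of (tau x).
    rewrite /f; case: pickP => [y /eqP /cell_of_inj -> //|/(_ x)].
    by rewrite eqxx.
  exists f; apply/allP=> _ /cell_ofP[x <-]; rewrite !fE tauK eqxx /=.
  apply/and3P; split; first by apply/cell_ofP; exists (tau x).
    apply/and3P; split.
    - by apply/eqP=> /cell_of_inj /R2.
    - by apply/implyP=> /R3; rewrite !piece_entry => ->.
    - have := R3 (tau x); rewrite tauK !piece_entry => h.
      by apply/implyP=> /h->.
  apply/implyP=> /cell_ofP[y yE]; rewrite -yE fE.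
  by case: yE => yr yc; apply: R1.
have {}fP (x : dec_index d) :=
  fP (cell_of x) (introT (cell_ofP _ _) (ex_intro _ x erefl)).
have /fin_all_exists[tau tauE] (x : dec_index d) :
    exists y : dec_index d, cell_of y = f (cell_of x).
  by apply/cell_ofP; case/and4P: (fP x).
exists tau; split.
- move=> x; apply: cell_of_inj; rewrite !tauE.
  by case/and4P: (fP x) => _ /eqP.
- move=> x y yr yc; have yE : cell_of y = (row_ix x, (col_ix x).+1).
    by rewrite /cell_of yr yc.
  case/and4P: (fP x) => _ _ _ /implyP; rewrite -yE -!tauE; apply.
  by apply/cell_ofP; exists y.
- move=> x xE; case/and4P: (fP x) => _ _ /and3P[+ _ _] _.
  by rewrite -tauE xE eqxx.
move=> x xlt; case/and4P: (fP x) => _ _ /and3P[_ /implyP h _] _.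
by rewrite !piece_entry tauE; apply/eqP/h; rewrite -tauE.
Qed.

Definition swap (c c' : cell) (g : cell -> cell) : cell -> cell :=
  fun b => if b == c then c' else if b == c' then c else g b.

(** The fixed-point free involutions of [s] pairing only [r]-related positions:
    the first position chooses a partner, and both are removed.  Pruning by [r]
    during the enumeration leaves very few candidates.  The fuel [n] is to be
    at least the length of [s]. *)
Fixpoint involutions (r : rel cell) (n : nat) (s : seq cell) :
    seq (cell -> cell) :=
  match n, s with
  | _, [::] => [:: id]
  | n'.+1, c :: s' =>
      flatten [seq map (swap c c') (involutions r n' (rem c' s'))
              | c' <- [seq c' <- s' | r c c']]
  | 0, _ :: _ => [::]
  end.

Lemma has_flatten (T : Type) (P : pred T) (ss : seq (seq T)) :
  has P (flatten ss) = has (has P) ss.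
Proof. by elim: ss => //= s ss IH; rewrite has_cat IH. Qed.

(** Completeness of the enumeration.  It produces functions, which can only be
    compared with [f] pointwise on [s]; hence the formulation by a predicate
    holding for all functions that agree with [f] there. *)
Lemma has_involutions (r : rel cell) (n : nat) (s : seq cell) (f : cell -> cell)
    (P : pred (cell -> cell)) :
  size s <= n -> uniq s ->
  {in s, forall c, [/\ f c \in s, f (f c) = c, f c != c & r c (f c)]} ->
  (forall g, {in s, g =1 f} -> P g) ->
  has P (involutions r n s).
Proof.
elim: n s P => [|n IH] [|c s] P //=; try by move=> _ _ _ HP; rewrite HP.
rewrite ltnS => sn /andP[cs us] fs HP.
have [+ ffc fc rc] := fs c (mem_head _ _); rewrite inE (negPf fc) /= => fcs.
rewrite has_flatten has_map; apply/hasP.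
exists (f c) => /=; first by rewrite mem_filter rc.
rewrite has_map; apply: IH; rewrite ?rem_uniq //.
- by rewrite (leq_trans _ sn) // size_rem // leq_pred.
- move=> b; rewrite mem_rem_uniq // => /andP[/= bfc bs].
  have [fbs ffb fb rb] := fs b (mem_behead (s := c :: s) bs).
  split=> //; rewrite mem_rem_uniq // !inE.
  apply/andP; split.
    by apply: contraNneq cs => e; rewrite -ffc -e ffb.
  case/predU1P: fbs => // e; by move: bfc; rewrite -e ffb eqxx.
move=> g gf; apply: HP => b; rewrite inE /= /swap.
case: eqVneq => [->//|bc] /= bs; case: eqVneq => [->//|bfc].
by apply: gf; rewrite mem_rem_uniq // !inE bfc.
Qed.

(** Pruning takes care of (R2) and (R3); [pairing] then tests (R1). *)
Definition relevantb (d : seq (seq segment)) : bool :=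
  has (pairing d) (involutions (linked d) (size (cells d)) (cells d)).

Lemma cells_uniq (d : seq (seq segment)) : uniq (cells d).
Proof.
apply: allpairs_uniq_dep => [|i _|[i j] [i' j'] _ _ /= [-> ->] //];
  exact: iota_uniq.
Qed.

Lemma relevantP (d : seq (seq segment)) : reflect (relevant d) (relevantb d).
Proof.
apply: (iffP idP) => [|/relevant_pairing[f /allP fP]].
  rewrite /relevantb => hd; apply/relevant_pairing.
  elim: (involutions _ _ _) hd => //= f fs IH.
  by case/orP=> // ?; exists f.
apply: (has_involutions (f := f)) => // [|c cd|g gf].
- exact: cells_uniq.
- by case/and4P: (fP c cd) => ? /eqP ? /[dup] ? /and3P[].
apply/allP=> c cd; have := fP c cd; case/and4P=> fc ffc lc R1.
rewrite (gf c cd) (gf (f c) fc) fc ffc lc; apply/implyP=> c'd; rewrite gf //.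
exact: (implyP R1).
Qed.

Lemma relevant_decomposition_existsP (s : seq segment)
    (P : pred (seq (seq segment))) :
  all (fun D => sg_end D <= sg_begin D + 1)%R s ->
  reflect (exists d, relevant_decomposition s d /\ P d)
    (has (fun d => relevantb d && P d) (choices [seq splits D | D <- s])).
Proof.
move=> hs; apply: (iffP hasP)
  => [[d + /andP[/relevantP rd Pd]]|[d [[+ /relevantP rd] Pd]]].
  by rewrite -decompositionP //; exists d.
by rewrite decompositionP //; exists d => //; rewrite rd.
Qed.

(** * The multisegment [m0] *)

Definition non_witnesses := [:: G1; G2; G3; G4; G5; G6].
Definition strong_witnesses := [:: W1; W2; W3].

Lemma all_short :
  all (all (fun D => sg_end D <= sg_begin D + 1)%R)
    (non_witnesses ++ strong_witnesses).
Proof. by vm_compute. Qed.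

Lemma standard_order_m0 (s : seq segment) :
  standard_order m0 s <-> s \in non_witnesses ++ strong_witnesses.
Proof.
rewrite /standard_order m0_seq_mset order_of_seq_mset.
have /perm_mem <- : perm_eq [seq s <- permutations G1 | standard s]
    (non_witnesses ++ strong_witnesses) by vm_compute.
rewrite mem_filter mem_permutations; split=> [[-> ->] //|/andP[-> ->] //].
Qed.

Lemma relevant_non_witnesses (s : seq segment) :
  s \in non_witnesses ->
  exists d, relevant_decomposition s d /\ ~~ trivial_decomposition d.
Proof.
move=> sG; apply/relevant_decomposition_existsP.
  by apply: (allP all_short); rewrite mem_cat sG.
by move: s sG; apply/allP; vm_compute.
Qed.

Lemma not_relevant_strong_witnesses (s : seq segment) :
  s \in strong_witnesses -> ~ exists d, relevant_decomposition s d.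
Proof.
move=> sW [d sd].
have: exists d, relevant_decomposition s d /\ predT d by exists d.
apply/relevant_decomposition_existsP.
  by apply: (allP all_short); rewrite mem_cat sW orbT.
by move: s sW {d sd}; apply/allP; vm_compute.
Qed.

Theorem theorem8p1 :
  ~ speh_type m0 /\
  (uniq [:: G1; G2; G3; G4; G5; G6; W1; W2; W3] /\
   (forall s : seq segment,
      standard_order m0 s <->
      s \in [:: G1; G2; G3; G4; G5; G6; W1; W2; W3])) /\
  ((forall s : seq segment, s \in [:: G1; G2; G3; G4; G5; G6] ->
      exists d, relevant_decomposition s d /\ ~~ trivial_decomposition d) /\
   (forall s : seq segment, s \in [:: W1; W2; W3] ->
      ~ exists d, relevant_decomposition s d) /\
   ~ distinguished m0 /\
   (forall s : seq segment, strong_witness m0 s <-> s \in [:: W1; W2; W3])) /\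
  ((forall s : seq segment,
      (standard_order m0 s /\ nonincreasing_ends s) <->
      s \in [:: G3; G4; G6]) /\
   (forall s : seq segment, witness m0 s -> ~~ nonincreasing_ends s) /\
   nonincreasing_begins W1 /\
   nonincreasing_begins W2).
Proof.
have ends s :
    standard_order m0 s /\ nonincreasing_ends s <-> s \in [:: G3; G4; G6].
  have -> : [:: G3; G4; G6] =
      [seq s <- non_witnesses ++ strong_witnesses | nonincreasing_ends s].
    by vm_compute.
  rewrite standard_order_m0 mem_filter; split=> [[-> ->] //|/andP[-> ->] //].
split.
  (* The two copies of [0,1] exceed the single copy of [1,2]. *)
  move/speh_type_chain => /(_ (Sg 0 1)); rewrite m0_seq_mset !mset_seqE.
  by vm_compute => /(_ erefl).
split; first by split; [vm_compute|exact: standard_order_m0].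
split.
  split; first exact: relevant_non_witnesses.
  split; first exact: not_relevant_strong_witnesses.
  split.
    move=> dist; have W1in : W1 \in strong_witnesses by rewrite mem_head.
    apply: (not_relevant_strong_witnesses W1in); apply: dist.
    by apply/standard_order_m0; rewrite mem_cat W1in orbT.
  move=> s; split=> [[/standard_order_m0]|sW].
    rewrite mem_cat => /orP[/relevant_non_witnesses[d [sd _]] []|//].
    by exists d.
  split; last exact: not_relevant_strong_witnesses.
  by apply/standard_order_m0; rewrite mem_cat sW orbT.
split; first exact: ends.
split=> [s [sm nos]|]; last by split; vm_compute.
apply/negP=> se; apply: nos; apply: relevant_non_witnesses.
have : s \in [:: G3; G4; G6] by apply/ends.
by move: s {sm se}; apply/allP; vm_compute.
Qed.
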